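(* Under the setting and assumptions of the first-method model (F satisfying (A1)–(A3); $y_{kj}=\beta_k+sx_j+\delta_{kj}$, $k=0,\dots,d$, with $x_j=-\log\varepsilon_j$ for a strictly decreasing sequence of radii $\varepsilon_j>0$; zero-mean errors with finite positive variances whose covariance matrices $Q_n$ satisfy $0<\inf_n\nu_{\min}(Q_n)\le\sup_n\nu_{\max}(Q_n)=:\nu^*<\infty$), the least squares estimator $\hat\beta^{(n)}$ of $\beta=(\beta_0,\dots,\beta_d,s)^\top$ satisfies, for every $\varepsilon>0$ and $n\ge2$, $$P(|\hat\beta^{(n)}-\beta|>\varepsilon)\le\frac{4\nu^*}{\varepsilon^2(d+1)n}\big(1+\bar x_n^2+\widetilde S_n^2\big)\Big(\frac1{\widetilde S_n^2}+(d+1)\Big(1+\frac{\bar x_n^2}{\widetilde S_n^2}\Big)\Big)^2.$$ Moreover, if there are constants $\gamma,\mu\ge0$ with $\widetilde S_n^2=\Theta(n^\gamma)$ and $\bar x_n=O(n^{\mu/2})$ as $n\to\infty$, and $\alpha:=1-\max\{\gamma,\mu\}-2\max\{0,\mu-\gamma\}>0$, then $P(|\hat\beta^{(n)}-\beta|>\varepsilon)=O(n^{-\alpha})$ for every $\varepsilon>0$.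
   Context: $F_\varepsilon$ is the $\varepsilon$-parallel set of $F$; $C_k(F_\varepsilon)$ its $k$-th total curvature (intrinsic volume); $s$ is the Minkowski dimension of $F$. (A1): curvature measures of $F_\varepsilon$ well defined for a.e. $\varepsilon$; (A2): each $C_k(F_\varepsilon)$ has constant strict sign in $\varepsilon$; (A3): $\mathcal C_k(F)=\operatorname{ess\,lim}_{\varepsilon\searrow0}\varepsilon^{s-k}C_k(F_\varepsilon)$ exists for all $k$, and $\beta_k=\log|\mathcal C_k(F)|$. $\bar x_n=\frac1n\sum_{i\le n}x_i$, $\widetilde S_n^2=\frac1n\sum_{i\le n}(x_i-\bar x_n)^2$. $Q_n$ is the covariance matrix of $(\delta_{01},\dots,\delta_{d1},\dots,\delta_{0n},\dots,\delta_{dn})$. $\hat\beta^{(n)}$ minimizes $\sum_{k=0}^d\sum_{j=1}^n(y_{kj}-\beta_k-sx_j)^2$. $f=\Theta(g)$ means $c_1|g|\le|f|\le c_2|g|$ eventually for constants $c_1,c_2>0$. *)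

(* Defs.v *)
From HB Require Import structures.
From mathcomp Require Import all_boot all_order all_algebra.
From mathcomp Require Import all_classical all_reals all_analysis.
Set Implicit Arguments. Unset Strict Implicit. Unset Printing Implicit Defensive.
Import Order.TTheory GRing.Theory Num.Theory.
Local Open Scope ring_scope.

(* Observations are indexed by k : 'I_d.+1 (k = 0..d) and by j : nat with
   0-based indexing: the paper's j = 1..n corresponds to j = 0..n-1 here. *)

Definition xbar {R : realType} (x : nat -> R) (n : nat) : R :=
  n%:R^-1 * \sum_(j < n) x j.

Definition S2 {R : realType} (x : nat -> R) (n : nat) : R :=
  n%:R^-1 * \sum_(j < n) (x j - xbar x n) ^+ 2.

Definition LSobj {R : realType} (d n : nat) (x : nat -> R)
  (y : 'I_d.+1 -> nat -> R) (b : 'I_d.+1 -> R) (s : R) : R :=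
  \sum_(k < d.+1) \sum_(j < n) (y k j - b k - s * x j) ^+ 2.

Definition pdist {R : realType} (d : nat) (b : 'I_d.+1 -> R) (s : R)
  (b' : 'I_d.+1 -> R) (s' : R) : R :=
  Num.sqrt (\sum_(k < d.+1) (b k - b' k) ^+ 2 + (s - s') ^+ 2).

(* position i of the stacked vector (delta_{0,1},...,delta_{d,1},...,
   delta_{0,n},...,delta_{d,n}) corresponds to k = i mod (d+1),
   j = i div (d+1) (0-based j). *)
Definition idx_k (d n : nat) (i : 'I_(n * d.+1)) : 'I_d.+1 := inord (i %% d.+1).
Definition idx_j (d n : nat) (i : 'I_(n * d.+1)) : nat := i %/ d.+1.

Definition covmx {dT : measure_display} {T : measurableType dT} {R : realType}
  (P : probability T R) (d : nat) (delta : 'I_d.+1 -> nat -> T -> R) (n : nat)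
  : 'M[R]_(n * d.+1) :=
  \matrix_(i, i') fine (covariance P (delta (idx_k i) (idx_j i))
                                     (delta (idx_k i') (idx_j i'))).

(* Main.v *)
Require Import Defs.
From HB Require Import structures.
From mathcomp Require Import all_boot all_order all_algebra.
From mathcomp Require Import all_classical all_reals all_analysis.
From mathcomp Require Import measurable_realfun sesquilinear spectral ring lra.
From mathcomp Require complex.
Import Order.TTheory GRing.Theory Num.Theory.
Local Open Scope classical_set_scope.
Local Open Scope ring_scope.

(** The normal equations express the estimation error linearly in the
    observation errors.  With D = d+1, the slope error is
    [sum_(l, j) delta_lj (x_j - xbar) / (D n S2)], and the k-th intercept error
    is the mean of the [delta_kj] minus [xbar] times the slope error.
    The expected squared error is thus a sum of quadratic forms of [Q_n], each
    at most [nustar] times the squared norm of its coefficient vector, by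
    diagonalization of [Q_n].  The squared norms add up to
    [(1/S2 + D (D + xbar^2/S2)) / (D n)], and Markov's inequality yields the
    tail bound, even without the factor 4.  The rate follows by inserting the
    growth conditions into this bound. *)


(** * Quadratic forms of symmetric and of covariance matrices *)

Section Rayleigh.

Import complex.
Local Open Scope sesquilinear_scope.

(* [spectral] diagonalizes over algebraically closed fields only, hence the
   detour through R[i]; the spectrum is real and consists of eigenvalues of Q. *)
Lemma rayleigh_le (R : rcfType) (n : nat) (Q : 'M[R]_n) (M : R) :
  Q^T = Q -> (forall a, eigenvalue Q a -> a <= M) ->
  forall v : 'rV[R]_n,
  \sum_i \sum_j v 0 i * v 0 j * Q i j <= M * \sum_i v 0 i ^+ 2.
Proof.
move=> Qsym QM v.
pose toC : {rmorphism R -> R[i]} := real_complex R.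
have toC_real a : toC a \is Num.real by apply/complex_realP; exists a.
pose QC := map_mx toC Q; pose vC := map_mx toC v.
have QCreal : QC \is a mxOver Num.real by apply/mxOverP => i j; rewrite mxE.
have QCherm : QC \is hermsymmx.
  apply: realsym_hermsym => //; apply/is_hermitianmxP.
  rewrite expr0 scale1r; apply/matrixP => i j.
  by rewrite !mxE -{1}Qsym mxE.
set p := spectralmx QC; set sp := spectral_diag QC.
have pU : p \is unitarymx by exact: spectral_unitarymx.
have QE : QC = invmx p *m diag_mx sp *m p.
  exact/orthomx_spectralP/hermitian_normalmx.
have spreal i : sp 0 i \is Num.real.
  by apply: (mxOverP (hermitian_spectral_diag_real QCherm)).
have spM i : sp 0 i <= toC M.
  have /complex_realP [a spE] := spreal i; rewrite spE.
  rewrite lecR; apply: QM.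
  (* Characteristic polynomials commute with the embedding [toC], so it suffices that [toC a] is an
     eigenvalue of [QC]; row [i] of [p] is an eigenvector, nonzero because it has norm 1. *)
  rewrite eigenvalue_root_char -(fmorph_root toC) map_char_poly.
  rewrite -eigenvalue_root_char -/QC.
  apply/eigenvalueP; exists (row i p); last first.
    apply/eqP => r0; have := row_unitarymxP pU i i.
    rewrite r0 dotmxE mul0mx mxE eqxx => /esym/eqP.
    by rewrite oner_eq0.
  rewrite QE mulmxA mulmxA -row_mul mulmxV ?unitarymx_unit//.
  by rewrite -row_mul mul1mx row_diag_mx -scalemxAl -rowE spE.
(* In the eigenbasis coordinates [u] the form becomes the sum of [sp 0 i] times the squared modulus
   of [u 0 i], and the squared norm is preserved. *)
pose u := vC *m invmx p.
have vE : vC = u *m p by rewrite /u mulmxKV ?unitarymx_unit.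
have vt : vC ^t* = vC^T.
  by apply/matrixP => i j; rewrite !mxE; apply/CrealP.
have ut : p *m vC^T = u ^t*.
  by rewrite -vt vE trmx_mul map_mxM mulmxA (unitarymxP pU) mul1mx.
have formE : toC (\sum_i \sum_j v 0 i * v 0 j * Q i j) = (vC *m QC *m vC^T) 0 0.
  rewrite mxE exchange_big rmorph_sum /=; apply: eq_bigr => j _.
  rewrite !mxE mulr_suml rmorph_sum /=; apply: eq_bigr => i _.
  by rewrite !mxE !rmorphM /= mulrAC.
have sqE : toC (\sum_i v 0 i ^+ 2) = \sum_i `|u 0 i| ^+ 2.
  transitivity ((vC *m vC^T) 0 0).
    by rewrite mxE rmorph_sum /=; apply: eq_bigr => i _; rewrite !mxE rmorphXn.
  rewrite {1}vE -mulmxA ut mxE; apply: eq_bigr => i _.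
  by rewrite !mxE -normCK.
rewrite -lecR [X in X <= _]formE [X in _ <= X]rmorphM /= sqE.
rewrite QE !mulmxA -/u -mulmxA ut mul_mx_diag mxE mulr_sumr.
apply: ler_sum => i _; rewrite !mxE mulrAC -normCK mulrC.
by rewrite ler_wpM2r// exprn_ge0.
Qed.

End Rayleigh.

(** The square expands into products, integrable by square integrability of the factors; with zero
    means the expectation of each product is a covariance. *)
Lemma expectation_sqr_lincomb (dT : measure_display) (T : measurableType dT)
  (R : realType) (P : probability T R) (I : finType) (X : I -> T -> R) (a : I -> R) :
  (forall i, X i \in Lfun P 2%:E) -> (forall i, ('E_P[X i] = 0)%E) ->
  ('E_P[(fun w => ((\sum_i a i * X i w) ^+ 2)%R)]
   = (\sum_i \sum_j a i * a j * fine (covariance P (X i) (X j)))%R%:E)%E.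
Proof.
move=> X2 EX.
have X1 i : X i \in Lfun P 1 by rewrite Lfun_subset12// fin_num_measure.
have XX i j : X i \* X j \in Lfun P 1 by exact: Lfun2_mul_Lfun1.
have -> : (fun w => (\sum_i a i * X i w) ^+ 2) =
    \sum_(Y <- [seq (a ij.1 * a ij.2) \o* (X ij.1 \* X ij.2) | ij : I * I]) Y.
  apply/funext => w; rewrite big_map fct_sumE big_enum /= expr2 big_distrlr /=.
  by rewrite pair_big /=; apply: eq_bigr => ij _ /=; ring.
rewrite expectation_sum; last first.
  by move=> Y /mapP[ij _ ->]; exact: Lfun_scale.
rewrite big_map big_enum /= pair_big /= -sumEFin; apply: eq_bigr => ij _.
rewrite expectationZl// covarianceE//; last exact: XX.
rewrite EX mul0e sube0 [RHS]EFinM fineK//.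
by apply: expectation_fin_num; exact: XX.
Qed.

(** * Least squares errors as linear forms in the observation errors *)

Lemma sum_idx (R : nmodType) (d n : nat) (F : 'I_d.+1 -> nat -> R) :
  \sum_(i < n * d.+1) F (idx_k i) (idx_j i) = \sum_(k < d.+1) \sum_(j < n) F k j.
Proof.
rewrite /idx_k /idx_j -(big_mkord xpredT (fun i => F (inord (i %% d.+1)%N) (i %/ d.+1)%N)).
rewrite big_nat_mul exchange_big /= big_mkord; apply: eq_bigr => j _.
rewrite mulSnr.
rewrite -{1}[(j * d.+1)%N]add0n big_addn addKn big_mkord; apply: eq_bigr => k _.
by rewrite addnC modnMDl modn_small// divnMDl// divn_small// addn0 inord_val.
Qed.

(** First variation: a quadratic in [h] that is minimal at 0 has no linear term. *)
Lemma normal_equation (R : realFieldType) (I : finType) (r z : I -> R) :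
  (forall h, \sum_i r i ^+ 2 <= \sum_i (r i - h * z i) ^+ 2) ->
  \sum_i r i * z i = 0.
Proof.
move=> H; set B := \sum_i _; set A := \sum_i z i ^+ 2.
have {}H h : 2 * h * B <= h ^+ 2 * A.
  have := H h.
  have -> : \sum_i (r i - h * z i) ^+ 2 = \sum_i r i ^+ 2 - 2 * h * B + h ^+ 2 * A.
    rewrite /B /A !mulr_sumr -sumrB -big_split /=; apply: eq_bigr => i _; ring.
  lra.
have A0 : 0 <= A by apply: sumr_ge0 => i _; exact: sqr_ge0.
(* The trial value is h = q = B / (A + 1), the shift by 1 covering A = 0; since B = q (A + 1), the
   inequality becomes q^2 (A + 2) <= 0. *)
have A1 : 0 < A + 1 by lra.
have BE : B = B / (A + 1) * (A + 1) by rewrite divfK// gt_eqF.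
have := H (B / (A + 1)); rewrite {2}BE; move: BE; set q := B / _ => BE Hq.
have q0 : 0 <= q ^+ 2 by exact: sqr_ge0.
suff /eqP : q ^+ 2 = 0 by rewrite sqrf_eq0 BE => /eqP ->; rewrite mul0r.
nra.
Qed.

Section LeastSquaresError.
Variables (R : realType) (d n : nat) (x : nat -> R).
Hypothesis n0 : (0 < n)%N.
Hypothesis S0 : 0 < S2 x n.

Let nR0 : n%:R != 0 :> R. Proof. by rewrite pnatr_eq0 -lt0n. Qed.

Let sum_const (m : nat) (c : R) : \sum_(j < m) c = m%:R * c.
Proof. by rewrite sumr_const card_ord mulr_natl. Qed.

Lemma sum_xbar : \sum_(j < n) x j = n%:R * xbar x n.
Proof. by rewrite /xbar mulrA divff// mul1r. Qed.

Lemma sum_centered : \sum_(j < n) (x j - xbar x n) = 0.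
Proof. by rewrite sumrB sum_xbar sum_const subrr. Qed.

Lemma sum_centered_sqr : \sum_(j < n) (x j - xbar x n) ^+ 2 = n%:R * S2 x n.
Proof. by rewrite /S2 mulrA divff// mul1r. Qed.

Lemma sum_centered_mul : \sum_(j < n) x j * (x j - xbar x n) = n%:R * S2 x n.
Proof.
rewrite -sum_centered_sqr -[RHS](addrNK (xbar x n * \sum_(j < n) (x j - xbar x n))).
rewrite {1}sum_centered mulr0 subr0 mulr_sumr -big_split /=.
by apply: eq_bigr => j _; ring.
Qed.

(* The coefficients of the error delta_lj in the errors of the estimated slope
   and of the estimated k-th intercept. *)
Definition slope_coef (j : nat) : R :=
  (x j - xbar x n) / (d.+1%:R * n%:R * S2 x n).

Definition intercept_coef (k l : 'I_d.+1) (j : nat) : R :=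
  (l == k)%:R / n%:R - xbar x n * slope_coef j.

Lemma sum_slope_coef_sqr :
  \sum_(l < d.+1) \sum_(j < n) slope_coef j ^+ 2 = (d.+1%:R * n%:R * S2 x n)^-1.
Proof.
rewrite sum_const /slope_coef.
under eq_bigr do rewrite expr_div_n.
rewrite -mulr_suml sum_centered_sqr.
by field; rewrite gt_eqF// nR0 nat1r pnatr_eq0.
Qed.

(** The cross term between the two parts of [intercept_coef] is a multiple of the sum of the
    centered [x j] and vanishes. *)
Lemma sum_intercept_coef_sqr k :
  \sum_(l < d.+1) \sum_(j < n) intercept_coef k l j ^+ 2
  = n%:R^-1 + xbar x n ^+ 2 / (d.+1%:R * n%:R * S2 x n).
Proof.
rewrite -sum_slope_coef_sqr mulr_sumr.
have -> : n%:R^-1 = \sum_(l < d.+1) ((l == k)%:R / n%:R : R).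
  by rewrite -mulr_suml (bigD1 k)//= eqxx big1 ?addr0 ?mul1r// => i /negPf ->.
rewrite -big_split /=; apply: eq_bigr => l _.
rewrite mulr_sumr.
transitivity (\sum_(j < n) ((l == k)%:R * n%:R^-1 ^+ 2
   - 2 * (l == k)%:R / n%:R * xbar x n / (d.+1%:R * n%:R * S2 x n) * (x j - xbar x n)
   + xbar x n ^+ 2 * slope_coef j ^+ 2)).
  apply: eq_bigr => j _; rewrite /intercept_coef /slope_coef.
  by case: (l == k); rewrite /=; ring.
rewrite big_split sumrB /= -[X in _ - X + _]mulr_sumr sum_centered mulr0 subr0.
by congr (_ + _); rewrite sum_const; field.
Qed.

Lemma LS_error (beta b : 'I_d.+1 -> R) (s s' : R) (delta : 'I_d.+1 -> nat -> R) :
  (forall c t,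
     LSobj n x (fun k j => beta k + s * x j + delta k j) b s'
     <= LSobj n x (fun k j => beta k + s * x j + delta k j) c t) ->
  s' - s = \sum_(l < d.+1) \sum_(j < n) slope_coef j * delta l j /\
  forall k, b k - beta k = \sum_(l < d.+1) \sum_(j < n) intercept_coef k l j * delta l j.
Proof.
move=> H.
pose e k := b k - beta k; pose t := s' - s.
(* Moving the minimizer along the direction (c, g) shows that the residuals are orthogonal to every
   fitted pattern [c k + g * x j]. *)
have key (c : 'I_d.+1 -> R) (g : R) :
    \sum_(k < d.+1) \sum_(j < n) (delta k j - e k - t * x j) * (c k + g * x j) = 0.
  rewrite pair_big /=.
  apply: (normal_equation _ _ (fun kj : 'I_d.+1 * 'I_n => delta kj.1 kj.2 - e kj.1 - t * x kj.2)
     (fun kj => c kj.1 + g * x kj.2)) => h.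
  have := H (fun k => b k + h * c k) (s' + h * g).
  rewrite /LSobj !pair_big /=; congr (_ <= _); apply: eq_bigr => kj _.
    by congr (_ ^+ 2); rewrite /e /t; ring.
  by congr (_ ^+ 2); rewrite /e /t; ring.
have eE k : e k = n%:R^-1 * \sum_(j < n) delta k j - t * xbar x n.
  (* Testing against the indicator of [k] isolates the k-th intercept error. *)
  have := key (fun l => (l == k)%:R) 0.
  rewrite (bigD1 k)//= [X in _ + X]big1 ?addr0; last first.
    by move=> l /negPf lk; apply: big1 => j _; rewrite lk mul0r addr0 mulr0.
  under eq_bigr do rewrite eqxx mul0r addr0 mulr1.
  rewrite sumrB sumrB -mulr_sumr sum_xbar sum_const => K.
  have -> : \sum_(j < n) delta k j = n%:R * e k + t * (n%:R * xbar x n) by lra.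
  by field.
have tE : t = \sum_(l < d.+1) \sum_(j < n) slope_coef j * delta l j.
  (* Testing against the centered regressor eliminates all intercept errors. *)
  have := key (fun _ => - xbar x n) 1.
  have -> : \sum_(k < d.+1) \sum_(j < n)
      (delta k j - e k - t * x j) * (- xbar x n + 1 * x j)
    = \sum_(k < d.+1) (\sum_(j < n) (x j - xbar x n) * delta k j
         - e k * \sum_(j < n) (x j - xbar x n) - t * \sum_(j < n) x j * (x j - xbar x n)).
    apply: eq_bigr => k _; rewrite !mulr_sumr -!sumrB; apply: eq_bigr => j _; ring.
  rewrite sum_centered sum_centered_mul.
  under eq_bigr do rewrite mulr0 subr0.
  rewrite sumrB sum_const => /eqP; rewrite subr_eq0 => /eqP K.
  transitivity ((d.+1%:R * n%:R * S2 x n)^-1 *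
     \sum_(k < d.+1) \sum_(j < n) (x j - xbar x n) * delta k j).
    rewrite K; field.
    by rewrite (gt_eqF S0) nR0 nat1r pnatr_eq0.
  rewrite mulr_sumr; apply: eq_bigr => k _; rewrite mulr_sumr; apply: eq_bigr => j _.
  by rewrite /slope_coef; ring.
split=> // k; rewrite -/(e k) eE tE mulr_suml.
have -> : \sum_(j < n) delta k j = \sum_(l < d.+1) (l == k)%:R * \sum_(j < n) delta l j.
  by rewrite (bigD1 k)//= eqxx mul1r [X in _ + X]big1 ?addr0// => l /negPf ->; rewrite mul0r.
rewrite mulr_sumr -sumrB; apply: eq_bigr => l _.
rewrite !mulr_sumr mulr_suml -sumrB; apply: eq_bigr => j _.
by rewrite /intercept_coef; ring.
Qed.

End LeastSquaresError.

Arguments slope_coef {R}.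
Arguments intercept_coef {R}.

(** * Tail bounds from second moments *)

Lemma markov_nneg (dT : measure_display) (T : measurableType dT) (R : realType)
    (P : probability T R) (Z : T -> R) (c : R) :
  measurable_fun [set: T] Z -> (forall w, 0 <= Z w) -> 0 < c ->
  (P [set w | (c < Z w)%R] <= (c^-1)%:E * 'E_P[Z])%E.
Proof.
move=> mZ Z0 c0; set A := [set w | _].
have mA : measurable A.
  rewrite (_ : A = [set: T] `&` Z @^-1` `]c, +oo[); first exact: mZ.
  by apply/seteqP; split=> [w|w [_]] /=; rewrite in_itv /= andbT.
rewrite -(expectation_indic P mA) muleC lee_pdivlMr// muleC -expectationZl; last first.
  apply/Lfun1_integrable.
  exact: integrable_indic.
apply: expectation_le => //.
- exact: measurable_funM.
- by move=> w /=; rewrite mulr_ge0// ltW.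
- apply/aeW => w /=; rewrite indicE; case: (boolP (w \in A)) => [|_].
    by rewrite inE /A /= => /ltW; rewrite mul1r.
  by rewrite mul0r.
Qed.

(** After Markov's inequality each summand contributes the quadratic form of the covariance matrix
    at the vector [a p], which [rayleigh_le] bounds. *)
Lemma sum_sqr_lincomb_tail (dT : measure_display) (T : measurableType dT)
    (R : realType) (P : probability T R) (m : nat) (X : 'I_m -> T -> R)
    (M : R) (J : finType) (a : J -> 'I_m -> R) (c : R) :
  (forall i, X i \in Lfun P 2%:E) -> (forall i, ('E_P[X i] = 0)%E) ->
  (forall l, eigenvalue (\matrix_(i, j) fine (covariance P (X i) (X j))) l -> l <= M) ->
  0 < c ->
  (P [set w | (c < \sum_p (\sum_i a p i * X i w) ^+ 2)%R]
   <= (c^-1 * (M * \sum_p \sum_i a p i ^+ 2))%R%:E)%E.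
Proof.
move=> X2 EX eigM c0.
have mX i : measurable_fun [set: T] (X i).
  by have := X2 i; rewrite inE => /andP[/[!inE]].
have mL p : measurable_fun [set: T] (fun w => (\sum_i a p i * X i w) ^+ 2).
  apply: measurable_funX; apply: measurable_sum => i.
  exact: measurable_funM.
have mZ : measurable_fun [set: T] (fun w => \sum_p (\sum_i a p i * X i w) ^+ 2).
  exact: measurable_sum.
apply: le_trans (markov_nneg _ _ _ P _ c mZ _ c0) _.
  by move=> w; apply: sumr_ge0 => p _; exact: sqr_ge0.
rewrite EFinM lee_pmul2l ?lte_fin ?invr_gt0//.
rewrite unlock; under eq_integral do rewrite -sumEFin.
rewrite ge0_integral_sum//; last 2 first.
- by move=> p; exact/measurable_EFinP.
- by move=> p w _; rewrite lee_fin sqr_ge0.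
rewrite mulr_sumr -sumEFin; apply: lee_sum => p _.
have := expectation_sqr_lincomb _ _ _ P _ X (a p) X2 EX.
rewrite unlock => ->; rewrite lee_fin.
set Q : 'M[R]_m := (\matrix_(i, j) _) in eigM.
have Qsym : Q^T = Q by apply/matrixP => i j; rewrite !mxE covarianceC.
have := rayleigh_le _ _ Q M Qsym eigM (\row_i a p i).
congr (_ <= _ * _); last by apply: eq_bigr => i _; rewrite mxE.
by apply: eq_bigr => i _; apply: eq_bigr => j _; rewrite !mxE.
Qed.

(** * Real estimates of the bound and of its growth *)

(** Zero empirical variance would make [x 0] and [x 1], both in the sample once n >= 2, equal to the
    mean. *)
Lemma S2_gt0 (R : realType) (x : nat -> R) (n : nat) :
  x 0%N != x 1%N -> (2 <= n)%N -> 0 < S2 x n.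
Proof.
move=> x01 n2; rewrite /S2 mulr_gt0 ?invr_gt0 ?ltr0n ?(ltnW n2)//.
rewrite lt0r sumr_ge0 ?andbT; last by move=> i _; exact: sqr_ge0.
apply: contra x01 => /eqP sum0.
have z j (jn : (j < n)%N) : x j = xbar x n.
  apply/eqP; rewrite -subr_eq0 -sqrf_eq0; apply/eqP.
  have sq0 (i : 'I_n) : true -> 0 <= (x i - xbar x n) ^+ 2 by move=> _; exact: sqr_ge0.
  exact: (psumr_eq0P sq0 sum0 (i := Ordinal jn) isT).
by rewrite (z 0%N) ?(z 1%N)// ltnW.
Qed.

(** With [B] the bracket on the right, the left side is B + D^2 - D. As B dominates D and 1/S, one
    has D^2 <= B^2 and B <= S B^2, so the left side is at most (1 + S) B^2. *)
Lemma risk_le_bound (R : realFieldType) (D S xb : R) : 1 <= D -> 0 < S ->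
  S^-1 + D * (D + xb ^+ 2 / S) <=
  4 * ((1 + xb ^+ 2 + S) * (S^-1 + D * (1 + xb ^+ 2 / S)) ^+ 2).
Proof.
move=> D1 S0; set B := S^-1 + D * (1 + _).
have u0 : 0 < S^-1 by rewrite invr_gt0.
have y0 : 0 <= xb ^+ 2 by exact: sqr_ge0.
have yu0 : 0 <= xb ^+ 2 / S by rewrite mulr_ge0// ltW.
have DB : D <= B by rewrite /B; nra.
have uB : S^-1 <= B by rewrite /B; nra.
have D2 : D ^+ 2 <= B ^+ 2 by rewrite ler_pXn2r ?nnegrE//; lra.
have SB : B <= S * B ^+ 2.
  rewrite expr2 mulrA -{1}[B]mul1r ler_wpM2r; [by []|lra|].
  by rewrite -(divff (lt0r_neq0 S0)) ler_pM2l.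
have yB : 0 <= xb ^+ 2 * B ^+ 2 by rewrite mulr_ge0// sqr_ge0.
have : S^-1 + D * (D + xb ^+ 2 / S) <= B ^+ 2 + B by rewrite {2}/B; nra.
nra.
Qed.

(** The factor 1 + xb^2 + S grows at most like n^max(gamma, mu). In the bracket 1/S stays bounded
    because gamma >= 0, and xb^2/S is of order n^(mu - gamma), so its square costs twice max(0, mu -
    gamma). *)
Lemma bound_asymptotics (R : realType) (D K c1 c2 C S xb gamma mu alpha : R) (n : nat) :
  (0 < n)%N -> 0 <= D -> 0 <= gamma -> 0 <= mu -> 0 < c1 -> 0 < c2 -> 0 < S ->
  c1 * n%:R `^ gamma <= S <= c2 * n%:R `^ gamma ->
  `|xb| <= C * n%:R `^ (mu / 2) ->
  alpha = 1 - Num.max gamma mu - 2 * Num.max 0 (mu - gamma) ->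
  K / n%:R * (1 + xb ^+ 2 + S) * (S^-1 + D * (1 + xb ^+ 2 / S)) ^+ 2 <=
  `|K| * (1 + C ^+ 2 + c2) * (c1^-1 + D * (1 + C ^+ 2 / c1)) ^+ 2 * n%:R `^ (- alpha).
Proof.
move=> n0 D0 g0 mu0 c10 c20 S0 /andP[Sl Su] xbC alphaE.
have n1 : 1 <= n%:R :> R by rewrite ler1n.
have nR0 : 0 < n%:R :> R by rewrite ltr0n.
set m := n%:R `^ Num.max gamma mu; set e := n%:R `^ Num.max 0 (mu - gamma).
set p := n%:R `^ gamma in Sl Su *.
have p0 : 0 < p by exact: powR_gt0.
have powE t u : n%:R `^ (t + u) = n%:R `^ t * n%:R `^ u :> R.
  by rewrite powRD//; apply/implyP => _; exact: lt0r_neq0.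
have pow_le t u : t <= u -> n%:R `^ t <= n%:R `^ u :> R by exact: ler_powR.
set q := n%:R `^ mu : R.
have xb2 : xb ^+ 2 <= C ^+ 2 * q.
  rewrite -(real_normK (num_real xb)).
  have -> : C ^+ 2 * q = (C * n%:R `^ (mu / 2)) ^+ 2.
    by rewrite exprMn [X in _ = _ * X]expr2 -powE -splitr.
  by rewrite ler_pXn2r// ?nnegrE// (le_trans _ xbC).
have one_pow t : 0 <= t -> 1 <= n%:R `^ t :> R.
  by move=> /pow_le; rewrite powRr0.
have m1 : 1 <= m by rewrite one_pow// le_max g0.
have qm : q <= m by rewrite pow_le// le_max lexx orbT.
have pm : p <= m by rewrite pow_le// le_max lexx.
have e1 : 1 <= e by rewrite one_pow// le_max lexx.
have p1 : 1 <= p by exact: one_pow.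
have C0 : 0 <= C ^+ 2 by exact: sqr_ge0.
have A1 : 1 + xb ^+ 2 + S <= (1 + C ^+ 2 + c2) * m by nra.
have iS : S^-1 <= c1^-1 * p^-1 by rewrite -invfM lef_pV2 ?posrE// mulr_gt0.
have ip1 : p^-1 <= 1 by rewrite invf_le1.
have ip0 : 0 < p^-1 by rewrite invr_gt0.
have ic0 : 0 < c1^-1 by rewrite invr_gt0.
have iS0 : 0 < S^-1 by rewrite invr_gt0.
have iSe : S^-1 <= c1^-1 * e by apply: le_trans iS _; rewrite ler_pM2l// (le_trans ip1).
have qp : q / p <= e.
  by rewrite /q /p -powRN -powE pow_le// le_max lexx orbT.
have q0 : 0 <= q by exact: powR_ge0.
have y0 : 0 <= xb ^+ 2 by exact: sqr_ge0.
have yS : xb ^+ 2 / S <= C ^+ 2 / c1 * e.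
  apply: (@le_trans _ _ (C ^+ 2 * q * (c1^-1 * p^-1))).
    by rewrite ler_pM// ltW.
  have -> : C ^+ 2 * q * (c1^-1 * p^-1) = C ^+ 2 / c1 * (q / p) by ring.
  by rewrite ler_wpM2l// mulr_ge0// ltW.
have B1 : S^-1 + D * (1 + xb ^+ 2 / S) <= (c1^-1 + D * (1 + C ^+ 2 / c1)) * e.
  by rewrite mulrDl lerD// -[leRHS]mulrA ler_wpM2l// mulrDl mul1r lerD.
have B0 : 0 <= S^-1 + D * (1 + xb ^+ 2 / S).
  by rewrite addr_ge0 ?(ltW iS0)// mulr_ge0// addr_ge0// divr_ge0// ltW.
have -> : n%:R `^ (- alpha) = m * e ^+ 2 / n%:R.
  have -> : - alpha = Num.max gamma mu + (Num.max 0 (mu - gamma) + Num.max 0 (mu - gamma)) + - 1.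
    by rewrite alphaE; ring.
  by rewrite !powE powR_inv1// ltW.
have -> : `|K| * (1 + C ^+ 2 + c2) * (c1^-1 + D * (1 + C ^+ 2 / c1)) ^+ 2 * (m * e ^+ 2 / n%:R)
  = `|K| / n%:R * ((1 + C ^+ 2 + c2) * m) * ((c1^-1 + D * (1 + C ^+ 2 / c1)) * e) ^+ 2 by ring.
set A := 1 + xb ^+ 2 + S in A1 *; set B := S^-1 + _ in B0 B1 *.
have A0 : 0 <= A by rewrite /A; lra.
have nV0 : 0 <= n%:R^-1 :> R by rewrite invr_ge0 ltW.
(* [K] may be negative, so it is replaced by its absolute value before the factors are compared. *)
apply: (@le_trans _ _ (`|K| / n%:R * A * B ^+ 2)).
  by rewrite ler_wpM2r ?sqr_ge0// ler_wpM2r// ler_wpM2r// ler_norm.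
apply: ler_pM.
- by rewrite mulr_ge0// mulr_ge0.
- exact: sqr_ge0.
- by rewrite ler_wpM2l// mulr_ge0.
- by rewrite ler_pXn2r ?nnegrE// (le_trans B0).
Qed.

(** * Tail bound and convergence rate of the least squares estimator *)

Theorem mainTheorem5
  (dT : measure_display) (T : measurableType dT) (R : realType)
  (P : probability T R) (d : nat)
  (* true parameters beta_k = log|C_k(F)| and s = dim_M F *)
  (beta : 'I_d.+1 -> R) (s : R)
  (* radii eps_j > 0, strictly decreasing; x_j = - log eps_j *)
  (r : nat -> R) (x : nat -> R)
  (* errors delta_kj *)
  (delta : 'I_d.+1 -> nat -> {RV P >-> R})
  (* the least squares estimator (betahat_0..betahat_d, shat) *)
  (bhat : nat -> T -> 'I_d.+1 -> R) (shat : nat -> T -> R)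
  (nustar : R) :
  (forall j, 0 < r j) ->
  (forall j, r j.+1 < r j) ->
  (forall j, x j = - ln (r j)) ->
  (forall k j, (delta k j : T -> R) \in Lfun P 2%:E) ->
  (forall k j, ('E_P[delta k j] = 0)%E) ->
  (forall k j, (0 < 'V_P[delta k j])%E) ->
  (exists c : R, 0 < c /\
     forall n a, (0 < n)%N -> eigenvalue (covmx P (fun k j => delta k j : T -> R) n) a ->
       c <= a) ->
  (exists M : R,
     forall n a, (0 < n)%N -> eigenvalue (covmx P (fun k j => delta k j : T -> R) n) a ->
       a <= M) ->
  nustar = sup [set a | exists n, (0 < n)%N /\
                  eigenvalue (covmx P (fun k j => delta k j : T -> R) n) a] ->
  (* bhat n, shat n minimize the least squares objective for the data
     y_kj = beta_k + s x_j + delta_kj, j < n *)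
  (forall n w (b : 'I_d.+1 -> R) (s' : R), (2 <= n)%N ->
     LSobj n x (fun k j => beta k + s * x j + delta k j w) (bhat n w) (shat n w)
     <= LSobj n x (fun k j => beta k + s * x j + delta k j w) b s') ->
  (forall (eps : R) (n : nat), 0 < eps -> (2 <= n)%N ->
     (P [set w | (eps < pdist (bhat n w) (shat n w) beta s)%R]
      <= ((4 * nustar / (eps ^+ 2 * d.+1%:R * n%:R))
          * (1 + xbar x n ^+ 2 + S2 x n)
          * ((S2 x n)^-1 + d.+1%:R * (1 + xbar x n ^+ 2 / S2 x n)) ^+ 2)%:E)%E)
  /\
  (forall gamma mu : R, 0 <= gamma -> 0 <= mu ->
     (* S2_n = Theta(n^gamma) *)
     (exists c1 c2 : R, 0 < c1 /\ 0 < c2 /\ exists N, forall n, (N <= n)%N ->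
        c1 * `|n%:R `^ gamma| <= `|S2 x n| <= c2 * `|n%:R `^ gamma|) ->
     (* xbar_n = O(n^(mu/2)) *)
     (exists C : R, exists N, forall n, (N <= n)%N ->
        `|xbar x n| <= C * `|n%:R `^ (mu / 2)|) ->
     let alpha := 1 - Num.max gamma mu - 2 * Num.max 0 (mu - gamma) in
     0 < alpha ->
     forall eps : R, 0 < eps ->
       exists C : R, exists N, forall n, (N <= n)%N ->
         (P [set w | (eps < pdist (bhat n w) (shat n w) beta s)%R]
          <= (C * `|n%:R `^ (- alpha)|)%:E)%E).
Proof.
move=> r0 rdec xE d2 Ed Vd eig_c [M eigM] nuE LS.
have x01 : x 0%N != x 1%N.
  by rewrite !xE eqr_opp gt_eqF// ltr_ln ?posrE.
have nu_ub n a : (0 < n)%N ->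
    eigenvalue (covmx P (fun k j => delta k j : T -> R) n) a -> a <= nustar.
  (* [sup] dominates a set only if the set is bounded above, which [M] witnesses. *)
  move=> n0 na; rewrite nuE; apply: ub_le_sup; last by exists n.
  by exists M => l [m [m0 ml]]; exact: (eigM m).
have tail (eps : R) n : 0 < eps -> (2 <= n)%N ->
    (P [set w | (eps < pdist (bhat n w) (shat n w) beta s)%R]
      <= ((4 * nustar / (eps ^+ 2 * d.+1%:R * n%:R))
          * (1 + xbar x n ^+ 2 + S2 x n)
          * ((S2 x n)^-1 + d.+1%:R * (1 + xbar x n ^+ 2 / S2 x n)) ^+ 2)%:E)%E.
  move=> eps0 n2; have n0 : (0 < n)%N by exact: ltnW.
  have S0 : 0 < S2 x n by exact: S2_gt0.
  (* The d + 2 components of the error are indexed by a disjoint union: slope on the left,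
     intercepts on the right. *)
  pose a (p : 'I_1 + 'I_d.+1) (i : 'I_(n * d.+1)) : R :=
    match p with
    | inl _ => slope_coef d n x (idx_j i)
    | inr k => intercept_coef d n x k (idx_k i) (idx_j i)
    end.
  pose X (i : 'I_(n * d.+1)) : T -> R := delta (idx_k i) (idx_j i).
  have -> : [set w | (eps < pdist (bhat n w) (shat n w) beta s)%R] =
      [set w | (eps ^+ 2 < \sum_p (\sum_i a p i * X i w) ^+ 2)%R].
    apply/seteqP; suff H w : (eps < pdist (bhat n w) (shat n w) beta s) =
        (eps ^+ 2 < \sum_p (\sum_i a p i * X i w) ^+ 2).
      by split=> w /=; rewrite H.
    have [sE bE] := LS_error _ _ _ _ n0 S0 beta (bhat n w) s (shat n w)
        (fun k j => delta k j w) (fun c t => LS n w c t n2).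
    rewrite big_sumType /= big_ord1.
    have -> : \sum_i slope_coef d n x (idx_j i) * X i w = shat n w - s.
      by rewrite sE -(sum_idx _ d n (fun l j => slope_coef d n x j * delta l j w)).
    have -> : \sum_(k < d.+1) (\sum_i intercept_coef d n x k (idx_k i) (idx_j i) * X i w) ^+ 2
        = \sum_(k < d.+1) (bhat n w k - beta k) ^+ 2.
      apply: eq_bigr => k _; congr (_ ^+ 2); rewrite bE.
      by rewrite -(sum_idx _ d n (fun l j => intercept_coef d n x k l j * delta l j w)).
    rewrite /pdist addrC; set Z := _ + _.
    have Z0 : 0 <= Z by rewrite addr_ge0 ?sqr_ge0// sumr_ge0// => k _; exact: sqr_ge0.
    by rewrite -[in RHS](sqr_sqrtr Z0) ltr_pXn2r// nnegrE ?sqrtr_ge0// ltW.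
  have DR0 : 0 < d.+1%:R :> R by rewrite ltr0n.
  have nR0 : 0 < n%:R :> R by rewrite ltr0n.
  have e20 : 0 < eps ^+ 2 by rewrite exprn_gt0.
  (* Up to the factor 1 / (D n), with D = d + 1, the slope contributes 1/S2 and each of the D
     intercepts D + xbar^2/S2. *)
  pose W := (S2 x n)^-1 + d.+1%:R * (d.+1%:R + xbar x n ^+ 2 / S2 x n).
  have aE : \sum_p \sum_i a p i ^+ 2 = W / (d.+1%:R * n%:R).
    rewrite big_sumType /= big_ord1.
    rewrite (sum_idx _ d n (fun l j => slope_coef d n x j ^+ 2)) sum_slope_coef_sqr//.
    under eq_bigr => k _.
      rewrite (sum_idx _ d n (fun l j => intercept_coef d n x k l j ^+ 2)).
      rewrite sum_intercept_coef_sqr//; over.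
    rewrite sumr_const card_ord -mulr_natl /W; field.
    by rewrite (gt_eqF S0) (gt_eqF nR0) nat1r pnatr_eq0.
  have := sum_sqr_lincomb_tail _ _ _ P _ X nustar _ a (eps ^+ 2)
    (fun i => d2 _ _) (fun i => Ed _ _) (fun l => nu_ub n l n0) e20.
  rewrite aE => tailW; apply: le_trans (tailW) _.
  have y0 : 0 <= xbar x n ^+ 2 / S2 x n by rewrite mulr_ge0 ?sqr_ge0// invr_ge0 ltW.
  have W0 : 0 < W by rewrite ltr_wpDr ?invr_gt0// mulr_ge0 ?addr_ge0// ltW.
  (* The sign comes from the tail bound itself: a probability is at most [nustar] times a positive
     factor. *)
  have nu0 : 0 <= nustar.
    have := le_trans (measure_ge0 P _) tailW.
    by rewrite lee_fin pmulr_rge0 ?invr_gt0// pmulr_lge0// divr_gt0// mulr_gt0.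
  rewrite lee_fin.
  have WB := risk_le_bound _ d.+1%:R _ (xbar x n) (ler1n _ _) S0.
  rewrite [leLHS](_ : _ = nustar / (eps ^+ 2 * d.+1%:R * n%:R) * W); last first.
    by field; rewrite (gt_eqF nR0) (gt_eqF eps0) nat1r pnatr_eq0.
  rewrite [leRHS](_ : _ = nustar / (eps ^+ 2 * d.+1%:R * n%:R) *
    (4 * ((1 + xbar x n ^+ 2 + S2 x n) *
     ((S2 x n)^-1 + d.+1%:R * (1 + xbar x n ^+ 2 / S2 x n)) ^+ 2))); last by ring.
  apply: ler_wpM2l; last exact: WB.
  by rewrite divr_ge0// !mulr_ge0// ltW.
split=> // gamma mu g0 mu0 [c1 [c2 [c10 [c20 [N1 SN]]]]] [C [N2 xN]] alpha _ eps eps0.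
(* This is the constant of [bound_asymptotics] for K = 4 nustar / (eps^2 (d + 1)); the threshold
   below includes 2 so that the tail bound applies. *)
exists (`|4 * nustar / (eps ^+ 2 * d.+1%:R)| * (1 + C ^+ 2 + c2)
  * (c1^-1 + d.+1%:R * (1 + C ^+ 2 / c1)) ^+ 2).
exists (maxn 2 (maxn N1 N2)) => n; rewrite !geq_max => /and3P[n2 nN1 nN2].
have S0 : 0 < S2 x n by exact: S2_gt0.
apply: le_trans (tail eps n eps0 n2) _; rewrite lee_fin.
rewrite (@ger0_norm _ (_ `^ _)) ?powR_ge0// (_ : 4 * nustar / (eps ^+ 2 * d.+1%:R * n%:R)
   = 4 * nustar / (eps ^+ 2 * d.+1%:R) / n%:R); last by rewrite [in LHS]invfM mulrA.
have := SN n nN1; rewrite (@ger0_norm _ (_ `^ _)) ?powR_ge0// (gtr0_norm S0) => {}SN.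
have := xN n nN2; rewrite (@ger0_norm _ (_ `^ _)) ?powR_ge0// => {}xN.
exact: (bound_asymptotics _ _ _ _ _ _ _ _ _ _ _ _ (ltnW n2) _ g0 mu0).
Qed.
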